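(* Let $CK(z)=\sum_{n\ge1}|CK_n|z^n$. Then, as formal power series, $$CK(z)=2z^2+\sum_{m\ge1}m!\,z^{m-1}\left(\frac{1-z}{1+z}\right)^{m-1}\frac{z(1-2z-z^2)}{(1+z)^2}.$$
   Context: $CK_n=\{\sigma\in S_n: |\sigma_i-\sigma_{i+1}|>1 \text{ for } 1\le i\le n-1, \text{ and } |\sigma_1-\sigma_n|>1\}$, the set of cylindrical king permutations (one-line notation); $CK_1=S_1$. *)

(* Defs.v *)
From mathcomp Require Import all_boot all_order all_algebra all_fingroup.
Set Implicit Arguments. Unset Strict Implicit. Unset Printing Implicit Defensive.
Import GRing.Theory Num.Theory.
Local Open Scope ring_scope.

(* One-line notation with values shifted to 0..n-1 (differences unchanged);
   positions are 0-indexed: position i of 'I_n is sigma_{i+1}. *)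
Definition absdiff (a b : nat) : nat := (maxn a b - minn a b)%N.

Definition is_ck (n : nat) (s : {perm 'I_n}) : bool :=
  (n == 1)%N ||
  ([forall i : 'I_n, forall j : 'I_n,
      (val j == (val i).+1)%N ==> (1 < absdiff (s i) (s j))%N] &&
   [forall i : 'I_n, forall j : 'I_n,
      ((val i == 0) && (val j == n.-1))%N ==> (1 < absdiff (s i) (s j))%N]).

Definition CK (n : nat) : {set {perm 'I_n}} := [set s | is_ck s].

Definition fps := nat -> rat.

Definition fps_of_poly (p : {poly rat}) : fps := fun n => p`_n.
Definition fps_one : fps := fun n => if n is 0 then 1 else 0.
Definition fps_add (f g : fps) : fps := fun n => f n + g n.
Definition fps_scale (c : rat) (f : fps) : fps := fun n => c * f n.
Definition fps_mul (f g : fps) : fps :=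
  fun n => \sum_(i < n.+1) f i * g (n - i)%N.
Definition fps_pow (f : fps) (k : nat) : fps := iter k (fps_mul f) fps_one.

Fixpoint fps_inv_seq (f : fps) (n : nat) : seq rat :=
  match n with
  | 0 => [:: (f 0%N)^-1]
  | n'.+1 => let s := fps_inv_seq f n' in
      rcons s (- (f 0%N)^-1 * \sum_(k < n'.+1) f k.+1 * nth 0 s (n' - k)%N)
  end.
Definition fps_inv (f : fps) : fps := fun n => nth 0 (fps_inv_seq f n) n.

(* Convergence of an infinite sum of series in the formal (z-adic) topology:
   every coefficient of the partial sums is eventually constant, equal to S. *)
Definition fps_partial_sum (T : nat -> fps) (M : nat) : fps :=
  fun n => \sum_(1 <= m < M.+1) T m n.
Definition fps_series_sums_to (T : nat -> fps) (S : fps) : Prop :=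
  forall n, exists N, forall M, (N <= M)%N -> fps_partial_sum T M n = S n.

Definition CK_gf : fps := fun n => if n is 0 then 0 else (#|CK n|)%:R.

Definition Z : fps := fps_of_poly 'X.
Definition one_minus_z : fps := fps_of_poly (1 - 'X).
Definition one_plus_z : fps := fps_of_poly (1 + 'X).
Definition quad : fps := fps_of_poly (1 - 2%:R *: 'X - 'X^2).

Definition rhs_term (m : nat) : fps :=
  fps_scale (m`!)%:R
    (fps_mul (fps_pow Z m.-1)
      (fps_mul (fps_pow (fps_mul one_minus_z (fps_inv one_plus_z)) m.-1)
        (fps_mul (fps_mul Z quad) (fps_inv (fps_pow one_plus_z 2))))).

Definition two_z2 : fps := fps_of_poly (2%:R *: 'X^2).

(* Main.v *)
(* A permutation, read cyclically, is a cyclic arrangement of [0..n-1] with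
   one of its [n] positions distinguished, and it is a cylindrical king
   permutation when no [i], [i+1] are neighbours in the arrangement. By inclusion-exclusion over the set [T] of
   pairs [i], [i+1] forced to be neighbours, one counts arrangements in which the
   values are grouped into [m = n - |T|] blocks: inserting the values one at a
   time shows that there are [(m-1)! 2^c] of them for [n >= 3], where [c] blocks
   have length at least two. With signs, a block has generating function
   [u = z - 2 z^2 + 2 z^3 - ... = z (1-z) / (1+z)], so that
   [|CK_n| = n * sum_m (m-1)! [z^n] u^m = sum_m m! [z^n] u^(m-1) (z u')], and
   [z u' = z (1 - 2z - z^2) / (1+z)^2]. The count [(m-1)! 2^c] is off for [n = 2],
   where the two neighbours of a value coincide; hence the term [2 z^2]. *)
From HB Require Import structures.
Require Import Defs.
From mathcomp Require Import all_boot all_order all_algebra all_fingroup.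
From mathcomp Require Import boolp zify ring.
Set Implicit Arguments. Unset Strict Implicit. Unset Printing Implicit Defensive.
Import GRing.Theory Num.Theory.

(** * Cyclic arrangements *)

Definition insert_after (n p : nat) (w : seq nat) : seq nat :=
  take (index p w).+1 w ++ n :: drop (index p w).+1 w.

(** Insertion always takes place after an existing element, so 0 stays at the head: each cyclic
    arrangement is represented by its rotation that starts with 0. *)
Fixpoint cyclic_words (k : nat) : seq (seq nat) :=
  if k is k'.+1
  then [seq insert_after k p w | w <- cyclic_words k', p <- iota 0 k]
  else [:: [:: 0]].

Definition cyc_adjacent (w : seq nat) (x y : nat) : bool :=
  (next w x == y) || (next w y == x).

Lemma perm_insert_after n p w : perm_eq (insert_after n p w) (n :: w).
Proof. by rewrite /insert_after -[n :: drop _ _]cat1s perm_catCA /= cat_take_drop. Qed.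

Lemma perm_rcons_iota n : perm_eq (n :: iota 0 n) (iota 0 n.+1).
Proof. by rewrite -[n.+1]addn1 iotaD -cat1s perm_catC. Qed.

Lemma perm_cyclic_words k w : w \in cyclic_words k -> perm_eq w (iota 0 k.+1).
Proof.
elim: k w => [|k IHk] w; first by rewrite inE => /eqP->.
case/allpairsP => -[w' p] [/IHk w'P _ ->].
by apply: perm_trans (perm_insert_after _ _ _) (perm_trans _ (perm_rcons_iota _));
  rewrite perm_cons.
Qed.

Lemma mem_cyclic_words k s : perm_eq (0 :: s) (iota 0 k.+1) -> 0 :: s \in cyclic_words k.
Proof.
elim: k s => [|k IHk] s sP.
  by rewrite inE; have /eqP := perm_size sP; case: s {sP}.
have : k.+1 \in 0 :: s by rewrite (perm_mem sP) mem_iota /= add0n ltnSn.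
rewrite inE => /predU1P[//|/splitPr] def_s; case: def_s sP => s1 s2 sP.
have Us : uniq (0 :: s1 ++ k.+1 :: s2) by rewrite (perm_uniq sP) iota_uniq.
have s12P : perm_eq (0 :: s1 ++ s2) (iota 0 k.+1).
  rewrite -(perm_cons k.+1) (perm_trans _ (perm_trans sP _)) //; last first.
    by rewrite perm_sym perm_rcons_iota.
  by rewrite perm_sym -cat_cons -[k.+1 :: s2]cat1s perm_catCA.
(* Delete the largest value; it had been inserted after its left neighbour, the last letter of
   [0 :: s1]. *)
apply/allpairsP; exists (0 :: s1 ++ s2, last 0 s1); split; first exact: IHk.
  have : last 0 s1 \in 0 :: s1 ++ s2 by rewrite -cat_cons mem_cat mem_last.
  by rewrite (perm_mem s12P).
have Us1 : uniq (0 :: s1) by move: Us; rewrite -cat_cons cat_uniq => /and3P[].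
rewrite /insert_after [_.1]/= [_.2]/= -!cat_cons index_cat mem_last index_last //.
by rewrite take_size_cat // drop_size_cat.
Qed.

Lemma size_cyclic_words k : size (cyclic_words k) = k`!.
Proof. by elim: k => // k IHk; rewrite size_allpairs IHk size_iota factS mulnC. Qed.

Lemma next_insert_after n p w x : uniq w -> n \notin w -> p \in w ->
  next (insert_after n p w) x =
    if x == n then next w p else if x == p then n else next w x.
Proof.
move=> Uw n'w pw.
have Uw' : uniq (insert_after n p w) by rewrite (perm_uniq (perm_insert_after _ _ _)) /= n'w.
have sz : size (take (index p w).+1 w) = (index p w).+1 by rewrite size_takel // index_mem.
have [t tE] : exists t, take (index p w).+1 w = rcons t p.
  by exists (take (index p w) w); rewrite (take_nth p) ?index_mem // nth_index.
(* Rotation by [size t] brings [p] to the head of both words, where [next] can be computed. *)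
have nw y : next w y = next (p :: drop (index p w).+1 w ++ t) y.
  rewrite -(next_rot (size t) Uw); congr (next _ y).
  by rewrite -{1}(cat_take_drop (index p w).+1 w) tE cat_rcons rot_size_cat.
have nw' y : next (insert_after n p w) y = next (p :: n :: drop (index p w).+1 w ++ t) y.
  rewrite -(next_rot (size t) Uw'); congr (next _ y).
  by rewrite /insert_after {1}tE cat_rcons rot_size_cat.
have n'p : (n == p) = false by apply: contraNF n'w => /eqP->.
rewrite nw' !nw /=; have [->|x'n] := eqVneq x n.
  by rewrite n'p; case: (drop _ _ ++ t) => [|y s] /=; rewrite !eqxx.
by have [//|x'p] := eqVneq x p; case: (drop _ _ ++ t) => [|y s] /=;
  rewrite (negPf x'n) (negPf x'p).
Qed.

Lemma next_neq (w : seq nat) x : uniq w -> 1 < size w -> x \in w -> next w x != x.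
Proof.
move=> Uw szw /rot_to[i s ws]; rewrite -(next_rot i Uw) ws.
have: uniq (x :: s) by rewrite -ws rot_uniq.
have: 1 < size (x :: s) by rewrite -ws size_rot.
by case: s {ws} => //= y s _; rewrite eqxx inE negb_or eq_sym => /andP[/andP[]].
Qed.

(** From three values on, the left and right neighbours of a value differ, so two values are side by
    side at one gap only. With two values this fails, which is where the correction in degree 2
    comes from. *)
Lemma next_next_neq (w : seq nat) x : uniq w -> 2 < size w -> x \in w -> next w (next w x) != x.
Proof.
move=> Uw szw /rot_to[i s ws]; rewrite -!(next_rot i Uw) ws.
have: uniq (x :: s) by rewrite -ws rot_uniq.
have: 2 < size (x :: s) by rewrite -ws size_rot.
case: s {ws} => [|y [|z s]] //= _; rewrite eqxx !inE !negb_or => /andP[/and3P[x'y x'z _] _].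
by rewrite [y == x]eq_sym (negPf x'y) eqxx [z == x]eq_sym.
Qed.

(** * Counting arrangements with prescribed adjacencies *)

Definition adjacent_on (T : bitseq) (w : seq nat) : bool :=
  all (fun i => nth false T i ==> cyc_adjacent w i i.+1) (iota 0 (size T)).

Lemma count_subset (T : eqType) (a : pred T) (s t : seq T) :
  uniq s -> uniq t -> {subset s <= t} ->
  count (fun x => (x \in s) && a x) t = count a s.
Proof.
move=> Us Ut sub_st; rewrite -!size_filter; apply/perm_size/uniq_perm; rewrite ?filter_uniq //.
by move=> x; rewrite !mem_filter; case: (boolP (x \in s)) => [/sub_st->|]; rewrite ?andbT ?andbF.
Qed.

(* The element after which an insertion separates [i] from [i.+1]. *)
Definition slot (w : seq nat) (i : nat) : nat := if next w i == i.+1 then i else i.+1.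

Definition slots (T : bitseq) (w : seq nat) : seq nat :=
  [seq slot w i | i <- iota 0 (size T) & nth false T i].

Lemma adjacent_on_rcons T b w :
  adjacent_on (rcons T b) w =
  adjacent_on T w && (b ==> cyc_adjacent w (size T) (size T).+1).
Proof.
rewrite /adjacent_on size_rcons -[X in iota 0 X]addn1 iotaD all_cat /= andbT add0n nth_rcons ltnn eqxx.
congr andb; apply: eq_in_all => i; rewrite mem_iota add0n /= => lti.
by rewrite nth_rcons lti.
Qed.

(* With [k.+1 > 2] values, each pair of neighbours spans a single gap, so every
   marked adjacency forbids exactly one place of insertion. *)
Section InsertLast.
Variables (k : nat) (w : seq nat) (T : bitseq).
Hypotheses (k_gt1 : 1 < k) (wP : perm_eq w (iota 0 k.+1)) (szT : size T = k).

Let Uw : uniq w. Proof. by rewrite (perm_uniq wP) iota_uniq. Qed.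
Let mem_w x : (x \in w) = (x <= k). Proof. by rewrite (perm_mem wP) mem_iota. Qed.
Let szw : size w = k.+1. Proof. by rewrite (perm_size wP) size_iota. Qed.

Lemma cyc_adjacent_insert p i : p <= k -> i < k ->
  cyc_adjacent (insert_after k.+1 p w) i i.+1 =
  cyc_adjacent w i i.+1 && (p != slot w i).
Proof.
move=> le_pk lt_ik; rewrite /cyc_adjacent !next_insert_after ?mem_w ?ltnn // /slot.
have := next_next_neq Uw (_ : 2 < size w) (_ : i \in w).
rewrite szw mem_w ltnS k_gt1 (ltnW lt_ik) => /(_ isT isT).
rewrite (ltn_eqF (ltnW lt_ik : i < k.+1)) (ltn_eqF (lt_ik : i.+1 < k.+1)).
by case: (eqVneq (next w i) i.+1) => [->|]; case: (eqVneq i p) => ?;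
  case: (eqVneq i.+1 p) => ?; lia.
Qed.

Lemma adjacent_on_insert p : p <= k ->
  adjacent_on T (insert_after k.+1 p w) = adjacent_on T w && (p \notin slots T w).
Proof.
move=> le_pk; apply/idP/andP => [/allP adjT|[/allP adjT slotT]].
  split.
    apply/allP => i iT; have := adjT i iT; rewrite cyc_adjacent_insert //.
      by case: nth => //= /andP[].
    by move: iT; rewrite mem_iota szT.
  apply/mapP => -[i]; rewrite mem_filter => /andP[Ti iT] pE.
  have := adjT i iT; rewrite Ti cyc_adjacent_insert // -?pE ?eqxx ?andbF //.
  by move: iT; rewrite mem_iota szT.
apply/allP => i iT; apply/implyP => Ti; rewrite cyc_adjacent_insert //; last first.
  by move: iT; rewrite mem_iota szT.
have := adjT i iT; rewrite Ti => /= -> /=; apply: contraNneq slotT => ->.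
by apply: map_f; rewrite mem_filter Ti.
Qed.

Hypothesis adjT : adjacent_on T w.

Lemma adjacent_onP i : i < k -> nth false T i -> cyc_adjacent w i i.+1.
Proof. by move=> ltik Ti; have /allP/(_ i) := adjT; rewrite mem_iota szT Ti; apply. Qed.

(** A slot and its successor in [w] are the two members of the marked pair, so the slot determines
    the pair. *)
Lemma uniq_slots : uniq (slots T w).
Proof.
rewrite map_inj_in_uniq ?filter_uniq ?iota_uniq // => i j.
rewrite !mem_filter !mem_iota szT /= => /andP[Ti lti] /andP[Tj ltj].
have := adjacent_onP lti Ti; have := adjacent_onP ltj Tj.
rewrite /cyc_adjacent /slot.
case: (eqVneq (next w j)) => nj; case: (eqVneq (next w i)) => ni //= /eqP nj' /eqP ni'.
- by move=> ij; move: ni'; rewrite ij; lia.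
- by move=> ij; move: nj'; rewrite -ij; lia.
by case.
Qed.

Lemma size_slots : size (slots T w) = count id T.
Proof.
rewrite size_map size_filter -[in RHS](mkseq_nth false T) /mkseq count_map.
by [].
Qed.

Lemma slots_le i : i \in slots T w -> i <= k.
Proof.
case/mapP => j; rewrite mem_filter mem_iota szT => /and3P[_ _ ltj] ->.
by rewrite /slot; case: ifP => _; lia.
Qed.

Lemma count_free_slots :
  count (fun p => p \notin slots T w) (iota 0 k.+1) = (count negb T).+1.
Proof.
have := count_predC (mem (slots T w)) (iota 0 k.+1).
have -> : count (mem (slots T w)) (iota 0 k.+1) = count id T.
  rewrite -size_slots -(count_predT (slots T w)).
  rewrite -(count_subset predT uniq_slots (iota_uniq 0 k.+1)) => [|x /slots_le].
    by apply: eq_count => x /=; rewrite andbT.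
  by rewrite mem_iota.
have := count_predC id T; rewrite szT size_iota (@eq_count _ (predC id) negb) //.
by rewrite (@eq_count _ (predC (mem _)) (fun p => p \notin slots T w)) //; lia.
Qed.

(** The new value [k.+1] becomes a neighbour of [k] only when placed just after [k] or just after
    [prev w k]. Among pairs of values up to [k], only [k.-1], [k] can occupy either gap; this lemma
    and the next one tell which of the two it blocks. *)
Lemma slots_last : k \in slots T w = last false T && (next w k.-1 != k).
Proof.
have lastT : last false T = nth false T k.-1 by rewrite -szT nth_last.
apply/mapP/andP => [[i]|[]].
  rewrite mem_filter mem_iota szT /slot lastT => /and3P[Ti _ lti].
  case: (eqVneq (next w i)) => [_ kE|ni kE]; first by move: lti; rewrite -kE ltnn.
  by rewrite [in next _ _]kE [in nth _ _ _]kE /= Ti kE.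
rewrite lastT => Tk nk; exists k.-1; first by rewrite mem_filter Tk mem_iota szT; lia.
by rewrite /slot prednK ?(ltnW k_gt1) // (negPf nk).
Qed.

Lemma slots_prev_last : prev w k \in slots T w = last false T && (next w k.-1 == k).
Proof.
have lastT : last false T = nth false T k.-1 by rewrite -szT nth_last.
have qk : next w (prev w k) = k by rewrite next_prev.
apply/mapP/andP => [[i]|[]].
  rewrite mem_filter mem_iota szT /slot lastT => /and3P[Ti _ lti].
  case: (eqVneq (next w i)) => [ni qi|ni qi].
    by move: qk; rewrite qi ni => <-; rewrite /= Ti ni.
  have := adjacent_onP lti Ti; rewrite /cyc_adjacent (negPf ni) /= -qi qk.
  by move=> /eqP ki; move: lti; rewrite -ki ltnn.
rewrite lastT => Tk /eqP nk; exists k.-1; first by rewrite mem_filter Tk mem_iota szT; lia.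
by rewrite /slot -{1}nk prev_next // nk prednK ?eqxx // ltnW.
Qed.

Lemma count_free_slots_last :
  count (fun p => (p \notin slots T w) && cyc_adjacent (insert_after k.+1 p w) k k.+1)
    (iota 0 k.+1) = 2 - last false T.
Proof.
have qk : next w (prev w k) = k by rewrite next_prev.
have q'k : prev w k != k.
  apply/eqP => E; have := next_neq Uw (_ : 1 < size w) (_ : k \in w).
  by rewrite -{2}E qk eqxx szw mem_w ltnS (ltnW k_gt1) leqnn => /(_ isT isT).
have qw : prev w k <= k by rewrite -mem_w mem_prev mem_w.
transitivity (count (fun p => p \notin slots T w) [:: k; prev w k]).
  rewrite -[RHS](count_subset _ _ (iota_uniq 0 k.+1)) => [||x].
  - apply: eq_in_count => p; rewrite mem_iota add0n ltnS => /= lepk.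
    rewrite andbC; congr andb; rewrite /cyc_adjacent !next_insert_after ?mem_w ?ltnn // eqxx.
    rewrite (ltn_eqF (ltnSn k)) !inE -[p == prev w k](can_eq (prev_next Uw)) qk [p == k]eq_sym.
    case: (k == p); first by rewrite eqxx.
    by rewrite ltn_eqF // ltnS -mem_w mem_next mem_w.
  - by rewrite /= inE eq_sym q'k.
  - by rewrite mem_iota leq0n add0n ltnS !inE => /orP[] /eqP->; rewrite /= ?leqnn.
by rewrite /= addn0 slots_last slots_prev_last; case: last; case: eqP.
Qed.

End InsertLast.

Lemma count_rcons (T : Type) (a : pred T) s x : count a (rcons s x) = (count a s + a x).
Proof. by rewrite -cats1 count_cat /= addn0. Qed.

(* Number of maximal runs of [true], a run at the head being counted only
   when [b] is false: a run of marked adjacencies is a block of length at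
   least two, which can be laid down in two directions. *)
Fixpoint runs (b : bool) (T : bitseq) : nat :=
  if T is x :: T' then ((x && ~~ b) + runs x T') else 0.

Lemma runs_rcons b T x : runs b (rcons T x) = (runs b T + (x && ~~ last b T)).
Proof. by elim: T b => [|y T IHT] b /=; rewrite ?addn0 // IHT addnA. Qed.

Definition marked_count (k : nat) (T : bitseq) : nat := count (adjacent_on T) (cyclic_words k).

Lemma count_allpairs (S T U : Type) (f : S -> T -> U) (a : pred U) s t :
  count a [seq f x y | x <- s, y <- t] = \sum_(x <- s) count (fun y => a (f x y)) t.
Proof.
by rewrite count_flatten -map_comp sumnE big_map; apply: eq_bigr => x _ /=; rewrite count_map.
Qed.

Lemma marked_countS k T b : marked_count k.+1 (rcons T b) =
  \sum_(w <- cyclic_words k)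
    count (fun p => adjacent_on (rcons T b) (insert_after k.+1 p w)) (iota 0 k.+1).
Proof. exact: count_allpairs. Qed.

(** The number of admissible insertions depends on [T] and [b] but not on the arrangement [w], so
    the count is multiplicative. *)
Lemma marked_count_rcons k T b : 1 < k -> size T = k ->
  marked_count k.+1 (rcons T b) =
  marked_count k T * (if b then 2 - last false T else (count negb T).+1).
Proof.
move=> k_gt1 szT; rewrite marked_countS mulnC /marked_count.
rewrite -[count _ (cyclic_words k)]sum1_count big_distrr.
rewrite [RHS]big_mkcond big_seq [RHS]big_seq; apply: eq_bigr => w /perm_cyclic_words wP.
case: ifPn => [adjT|adjT]; last first.
  transitivity (count pred0 (iota 0 k.+1)); last exact: count_pred0.
  apply: eq_in_count => p.
  rewrite mem_iota => /= lep; rewrite adjacent_on_rcons (adjacent_on_insert _ wP) //.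
  by rewrite (negPf adjT).
apply: etrans (esym (muln1 _)); case: b.
  rewrite -(count_free_slots_last k_gt1 wP szT adjT); apply: eq_in_count => p.
  rewrite mem_iota => /= lep; rewrite adjacent_on_rcons (adjacent_on_insert _ wP) //.
  by rewrite adjT szT.
rewrite -(count_free_slots k_gt1 wP szT adjT); apply: eq_in_count => p.
rewrite mem_iota => /= lep; rewrite adjacent_on_rcons (adjacent_on_insert _ wP) //.
by rewrite adjT andbT.
Qed.

Lemma marked_countE k T : 1 < k -> size T = k ->
  marked_count k T = (count negb T)`! * 2 ^ runs false T.
Proof.
elim: k T => // k IHk T; rewrite ltnS leq_eqVlt => /predU1P[<-|k_gt1].
  (* Three values: the four markings of two pairs are evaluated directly. *)
  by case: T => [|[] [|[] []]].
case/lastP: T => [//|T b]; rewrite size_rcons => -[szT].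
rewrite marked_count_rcons // IHk // runs_rcons count_rcons.
case: b => /=; last by rewrite addn1 addn0 factS; lia.
by rewrite addn0 expnD mulnA; case: last.
Qed.

(** * From permutations to cyclic arrangements *)

Definition non_adjacent (k : nat) (w : seq nat) : bool :=
  all (fun i => ~~ cyc_adjacent w i i.+1) (iota 0 k).

Lemma non_adjacent_rot k r w : uniq w -> non_adjacent k (rot r w) = non_adjacent k w.
Proof. by move=> Uw; apply: eq_all => i; rewrite /cyc_adjacent !next_rot. Qed.

Lemma next_nth_uniq (w : seq nat) i : uniq w -> i < size w ->
  next w (nth 0 w i) = nth 0 w (if i.+1 == size w then 0 else i.+1).
Proof.
move=> Uw lti; rewrite next_nth mem_nth // index_uniq //.
case: w Uw lti => //= x w _; rewrite eqSS ltnS leq_eqVlt.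
case: eqP => [-> _|_ /= lti]; first by rewrite nth_default.
by apply: set_nth_default.
Qed.

Definition word_of (n : nat) (s : {perm 'I_n}) : seq nat := [seq val (s i) | i <- enum 'I_n].

Lemma size_word_of n (s : {perm 'I_n}) : size (word_of s) = n.
Proof. by rewrite size_map size_enum_ord. Qed.

Lemma nth_word_of n (s : {perm 'I_n}) (i : 'I_n) : nth 0 (word_of s) i = s i.
Proof. by rewrite (nth_map i) ?size_enum_ord // nth_ord_enum. Qed.

Lemma uniq_word_of n (s : {perm 'I_n}) : uniq (word_of s).
Proof. by rewrite map_inj_uniq ?enum_uniq // => i j /val_inj/perm_inj. Qed.

Lemma perm_word_of n (s : {perm 'I_n}) : perm_eq (word_of s) (iota 0 n).
Proof.
apply: uniq_perm; rewrite ?uniq_word_of ?iota_uniq // => x; rewrite mem_iota add0n /=.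
apply/mapP/idP => [[i _ ->]|ltx]; first exact: ltn_ord.
exists ((s^-1)%g (Ordinal ltx)); first by rewrite mem_enum.
by rewrite permKV.
Qed.

Lemma word_of_inj n : injective (@word_of n).
Proof.
by move=> s t st; apply/permP => i; apply: val_inj; rewrite /= -!nth_word_of st.
Qed.

(** With [ordS] as cyclic successor of positions, the inner condition and the wrap-around condition
    become one condition on [next]. *)
Lemma is_ck_next k (s : {perm 'I_k.+1}) : 0 < k ->
  is_ck s = all (fun x => 1 < absdiff x (next (word_of s) x)) (word_of s).
Proof.
move=> k_gt0; rewrite /is_ck eqSS (gtn_eqF k_gt0) /=.
have nxt (i : 'I_k.+1) : next (word_of s) (s i) = s (ordS i).
  rewrite -nth_word_of next_nth_uniq ?uniq_word_of ?size_word_of // -nth_word_of /=.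
  congr nth; case: eqP => [->|]; first by rewrite modnn.
  by move=> /eqP nei; rewrite modn_small // ltn_neqAle nei ltn_ord.
have absdiffC a b : absdiff a b = absdiff b a by rewrite /absdiff maxnC minnC.
apply/andP/allP => [[/forallP inner /forallP wrap] x|ckP].
  case/mapP => i _ ->; rewrite nxt; case: (eqVneq (nat_of_ord i) k) => ik.
    have /forallP/(_ i)/implyP H := wrap (ordS i).
    by rewrite absdiffC H //= ik modnn !eqxx.
  have /forallP/(_ (ordS i))/implyP H := inner i; rewrite H //=.
  by rewrite modn_small // ltn_neqAle eqSS ik ltn_ord.
have ck i : 1 < absdiff (s i) (s (ordS i)) 
  by rewrite -nxt; apply/ckP/(map_f (fun i => val (s i))); rewrite mem_enum.
split; apply/forallP => i; apply/forallP => j; apply/implyP.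
  move=> /eqP ji; have -> : j = ordS i; last exact: ck.
  by apply: val_inj; rewrite /= modn_small -?ji.
move=> /andP[/eqP i0 /eqP jk]; rewrite absdiffC; have -> : i = ordS j; last exact: ck.
by apply: val_inj; rewrite /= i0 jk modnn.
Qed.

(** This passes from neighbouring positions to consecutive values: neighbours are distinct, so if
    they differ by at most 1 they are some [i] and [i.+1]. *)
Lemma all_next_non_adjacent k w : 0 < k -> perm_eq w (iota 0 k.+1) ->
  all (fun x => 1 < absdiff x (next w x)) w = non_adjacent k w.
Proof.
move=> k_gt0 wP; have Uw : uniq w by rewrite (perm_uniq wP) iota_uniq.
have mem_w x : (x \in w) = (x <= k) by rewrite (perm_mem wP) mem_iota.
apply/allP/allP => [farP i|adjP x xw].
  rewrite mem_iota => /= lti; rewrite negb_or.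
  have := farP i; have := farP i.+1; rewrite !mem_w /absdiff => /(_ lti) + /(_ (ltnW lti)).
  lia.
have := next_neq Uw _ xw; rewrite (perm_size wP) size_iota ltnS => /(_ k_gt0).
have nw : next w x \in w by rewrite mem_next.
rewrite ltnNge; move=> nx; apply/negP => close.
have [lt|gt] : next w x = x.+1 \/ x = (next w x).+1 by move: close nx; rewrite /absdiff; lia.
  have /adjP : x \in iota 0 k by rewrite mem_iota /= -mem_w -lt.
  by rewrite /cyc_adjacent lt eqxx.
have /adjP : next w x \in iota 0 k by rewrite mem_iota /= -mem_w -gt.
by rewrite /cyc_adjacent -gt eqxx orbT.
Qed.

(** The [k.+1] rotations of the words headed by 0 run through all permutations once each, and the
    condition is invariant under rotation. *)
Lemma card_CK k : 0 < k ->
  #|CK k.+1| = k.+1 * count (non_adjacent k) (cyclic_words k).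
Proof.
move=> k_gt0; pose rots := [seq rot r w | w <- cyclic_words k, r <- iota 0 k.+1].
pose words := [seq word_of s | s <- enum {perm 'I_k.+1}].
have Uwords : uniq words by rewrite map_inj_uniq ?enum_uniq //; apply: word_of_inj.
have sub_words : {subset words <= rots}.
  move=> _ /mapP[s _ ->].
  have z_s : 0 \in word_of s by rewrite (perm_mem (perm_word_of s)) mem_iota.
  have := rot_index z_s; set t := drop _ _ ++ _; set i := index _ _ => ti.
  have tP : perm_eq (0 :: t) (iota 0 k.+1) by rewrite -ti perm_rot perm_word_of.
  have szt : size (0 :: t) = k.+1 by rewrite (perm_size tP) size_iota.
  have lti : i < k.+1 by rewrite -(size_word_of s) index_mem.
  have ws : word_of s = rotr i (0 :: t) by rewrite -ti rotK.
  (* [rotr i] is [rot (k.+1 - i)] here; for [i = 0] this amount falls outside [iota 0 k.+1] and is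
     replaced by 0. *)
  apply/allpairsP; exists (0 :: t, if i == 0 then 0 else k.+1 - i).
  split; first exact: mem_cyclic_words.
    by rewrite mem_iota add0n; case: eqP => /= i0; lia.
  rewrite ws /rotr szt; case: eqP => [->|//].
  by rewrite subn0 -szt rot_size rot0.
(* Both lists have [(k.+1)!] entries, so the inclusion of the duplicate-free [words] in [rots] is an
   equality up to order. *)
have sz : size rots = size words.
  rewrite size_allpairs size_map -cardE size_cyclic_words size_iota.
  by rewrite card_Sn factS mulnC.
have wordsP : perm_eq words rots.
  have [_ eq_wr] := uniq_min_size Uwords sub_words (eq_leq sz).
  by apply: uniq_perm => //; apply: leq_size_uniq Uwords sub_words (eq_leq sz).
transitivity (count (non_adjacent k) words).
  rewrite cardE {1}/enum_mem size_filter -enumT [RHS]count_map; apply: eq_count => s.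
  by rewrite /= inE is_ck_next // (all_next_non_adjacent k_gt0 (perm_word_of s)).
rewrite (seq.permP wordsP) count_allpairs -sum1_count big_distrr [RHS]big_mkcond.
rewrite big_seq [RHS]big_seq; apply: eq_bigr => w /perm_cyclic_words wP.
have Uw : uniq w by rewrite (perm_uniq wP) iota_uniq.
rewrite (@eq_count _ _ (fun=> non_adjacent k w)) => [|r]; last exact: non_adjacent_rot.
case: ifP => _; last exact: count_pred0.
by rewrite count_predT size_iota; apply: esym (muln1 _).
Qed.

Lemma card_CK1 : #|CK 1| = 1.
Proof.
by rewrite -[RHS](card_Sn 1); apply: eq_card => s; rewrite !inE.
Qed.

Lemma card_CK2 : #|CK 2| = 0.
Proof. by rewrite card_CK. Qed.

Local Open Scope ring_scope.

(** * Formal power series *)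

Definition fps_opp (f : fps) : fps := fun n => - f n.

(** Low coefficients of a product depend only on truncations, so commutativity and associativity are
    inherited from polynomials. *)
Definition truncation (N : nat) (f : fps) : {poly rat} := \poly_(i < N) f i.

Lemma coef_truncation N f i : (i < N)%N -> (truncation N f)`_i = f i.
Proof. by move=> ltiN; rewrite coef_poly ltiN. Qed.

Lemma fps_mul_truncation N f g n : (n < N)%N ->
  fps_mul f g n = (truncation N f * truncation N g)`_n.
Proof.
move=> ltnN; rewrite coefM; apply: eq_bigr => i _.
by rewrite !coef_truncation // (leq_ltn_trans _ ltnN) // ?leq_subr // -ltnS.
Qed.

Lemma coefM_eq_low (p q r : {poly rat}) n :
  (forall i, (i <= n)%N -> q`_i = r`_i) -> (p * q)`_n = (p * r)`_n.
Proof. by move=> qr; rewrite !coefM; apply: eq_bigr => i _; rewrite qr ?leq_subr. Qed.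

Lemma fps_mulC : commutative fps_mul.
Proof.
by move=> f g; apply/funext => n; rewrite !(fps_mul_truncation _ _ (ltnSn n)) mulrC.
Qed.

Lemma fps_mulA : associative fps_mul.
Proof.
have trM f g n i : (i <= n)%N ->
    (truncation n.+1 (fps_mul f g))`_i = (truncation n.+1 f * truncation n.+1 g)`_i.
  by move=> lein; rewrite coef_truncation // (fps_mul_truncation (N := n.+1)).
move=> f g h; apply/funext => n; rewrite !(fps_mul_truncation _ _ (ltnSn n)).
rewrite (coefM_eq_low _ (@trM g h n)) [in RHS]mulrC (coefM_eq_low _ (@trM f g n)).
by rewrite mulrA mulrC.
Qed.

Lemma fps_mul1 : left_id fps_one fps_mul.
Proof.
move=> f; apply/funext => n; rewrite /fps_mul big_ord_recl subn0 mul1r big1 ?addr0 //.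
by move=> i _; rewrite mul0r.
Qed.

Lemma fps_mulDl : left_distributive fps_mul fps_add.
Proof.
move=> f g h; apply/funext => n; rewrite /fps_add /fps_mul -big_split /=.
by apply: eq_bigr => i _; rewrite mulrDl.
Qed.

Lemma fps_addA : associative fps_add.
Proof. by move=> f g h; apply/funext => n; apply: addrA. Qed.
Lemma fps_addC : commutative fps_add.
Proof. by move=> f g; apply/funext => n; apply: addrC. Qed.
Lemma fps_add0 : left_id (fun=> 0 : rat) fps_add.
Proof. by move=> f; apply/funext => n; apply: add0r. Qed.
Lemma fps_addN : left_inverse (fun=> 0 : rat) fps_opp fps_add.
Proof. by move=> f; apply/funext => n; apply: addNr. Qed.
HB.instance Definition _ := gen_eqMixin fps.
HB.instance Definition _ := gen_choiceMixin fps.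
HB.instance Definition _ :=
  GRing.isZmodule.Build fps fps_addA fps_addC fps_add0 fps_addN.
Lemma fps_1neq0 : fps_one != 0 :> fps.
Proof. by apply/eqP => /(congr1 (fun f : fps => f 0%N)). Qed.
HB.instance Definition _ := GRing.Zmodule_isComNzRing.Build fps
  fps_mulA fps_mulC fps_mul1 fps_mulDl fps_1neq0.

Lemma fps_powE (f : fps) k : fps_pow f k = f ^+ k.
Proof. by elim: k => [|k IHk] //; rewrite exprS -IHk. Qed.

Lemma coefD_fps (f g : fps) n : (f + g) n = f n + g n. Proof. by []. Qed.
Lemma coefN_fps (f : fps) n : (- f) n = - f n. Proof. by []. Qed.
Lemma coefMn_fps (f : fps) k n : (f *+ k) n = f n *+ k.
Proof. by elim: k => [|k IHk] //; rewrite !mulrS coefD_fps IHk. Qed.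

Lemma fps_scale_natr k (f : fps) : fps_scale k%:R f = f *+ k.
Proof. by apply/funext => n; rewrite coefMn_fps /fps_scale mulr_natl. Qed.

Lemma coefZ_mul0 (f : fps) : (Z * f) 0%N = 0.
Proof. by rewrite /GRing.mul /= /fps_mul big_ord1 /Z /fps_of_poly coefX mul0r. Qed.

Lemma coefZ_mulS (f : fps) n : (Z * f) n.+1 = f n.
Proof.
rewrite /GRing.mul /= /fps_mul !big_ord_recl big1 => [|i _].
  by rewrite /Z /fps_of_poly !coefX mul0r mul1r add0r addr0 subSS subn0.
by rewrite /Z /fps_of_poly coefX mul0r.
Qed.

Lemma coefZX_mul_lt (f : fps) m n : (n < m)%N -> (Z ^+ m * f) n = 0.
Proof.
elim: m n => [//|m IHm] [|n] lt_nm; first by rewrite exprS -mulrA coefZ_mul0.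
by rewrite exprS -mulrA coefZ_mulS IHm.
Qed.

Lemma size_fps_inv_seq f n : size (fps_inv_seq f n) = n.+1.
Proof. by elim: n => //= n IHn; rewrite size_rcons IHn. Qed.

Lemma nth_fps_inv_seq f n k : (k <= n)%N -> nth 0 (fps_inv_seq f n) k = fps_inv f k.
Proof.
elim: n => [|n IHn]; first by case: k.
rewrite leq_eqVlt => /predU1P[-> //|lt_kn].
by rewrite /= nth_rcons size_fps_inv_seq lt_kn IHn.
Qed.

Lemma fps_invS f n :
  fps_inv f n.+1 = - (f 0%N)^-1 * \sum_(k < n.+1) f k.+1 * fps_inv f (n - k)%N.
Proof.
rewrite {1}/fps_inv /= nth_rcons size_fps_inv_seq ltnn eqxx.
by congr (_ * _); apply: eq_bigr => k _; rewrite nth_fps_inv_seq ?leq_subr.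
Qed.

Lemma fps_mulV (f : fps) : f 0%N != 0 -> f * fps_inv f = 1.
Proof.
move=> f0; apply/funext => -[|n]; rewrite /GRing.mul /= /fps_mul.
  by rewrite big_ord1 divff.
rewrite big_ord_recl subn0 fps_invS mulrA mulrN divff // mulN1r.
by apply/eqP; rewrite addrC subr_eq0.
Qed.

Lemma fps_of_polyD p q : fps_of_poly (p + q) = fps_of_poly p + fps_of_poly q.
Proof. by apply/funext => n; rewrite /fps_of_poly coefD. Qed.
Lemma fps_of_polyN p : fps_of_poly (- p) = - fps_of_poly p.
Proof. by apply/funext => n; rewrite /fps_of_poly coefN. Qed.
Lemma fps_of_poly1 : fps_of_poly 1 = 1.
Proof. by apply/funext => -[|n]; rewrite /fps_of_poly coef1. Qed.
Lemma fps_of_polyMX p : fps_of_poly (p * 'X) = Z * fps_of_poly p.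
Proof.
apply/funext => -[|n]; rewrite ?coefZ_mul0 ?coefZ_mulS /fps_of_poly coefMX //.
Qed.

Lemma one_minus_zE : one_minus_z = 1 - Z.
Proof. by rewrite /one_minus_z fps_of_polyD fps_of_polyN fps_of_poly1. Qed.
Lemma one_plus_zE : one_plus_z = 1 + Z.
Proof. by rewrite /one_plus_z fps_of_polyD fps_of_poly1. Qed.
Lemma quadE : quad = 1 - Z *+ 2 - Z ^+ 2.
Proof.
rewrite /quad scaler_nat 2!fps_of_polyD !fps_of_polyN fps_of_poly1.
by rewrite [in X in 1 - X - _]mulr2n fps_of_polyD -mulr2n expr2 fps_of_polyMX expr2.
Qed.

(** * The Euler derivative and the block series *)

Definition euler_deriv (f : fps) : fps := fun n => f n *+ n.

Lemma euler_derivD f g : euler_deriv (f + g) = euler_deriv f + euler_deriv g.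
Proof. by apply/funext => n; rewrite /euler_deriv coefD_fps mulrnDl. Qed.
Lemma euler_derivN f : euler_deriv (- f) = - euler_deriv f.
Proof. by apply/funext => n; rewrite /euler_deriv coefN_fps mulNrn. Qed.
Lemma euler_derivM f g :
  euler_deriv (f * g) = euler_deriv f * g + f * euler_deriv g.
Proof.
apply/funext => n; rewrite coefD_fps /euler_deriv /GRing.mul /= /fps_mul.
rewrite -big_split -sumrMnl; apply: eq_bigr => i _ /=.
by rewrite mulrnAl mulrnAr -mulrnDr subnKC // -ltnS.
Qed.
Lemma euler_deriv1 : euler_deriv 1 = 0.
Proof. by apply/funext => -[|n]; rewrite /euler_deriv //= mul0rn. Qed.
Lemma euler_derivZ : euler_deriv Z = Z.
Proof.
apply/funext => n; rewrite /euler_deriv /Z /fps_of_poly coefX.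
by case: eqP => [->|]; rewrite ?mul0rn.
Qed.
Lemma euler_derivX f k : euler_deriv (f ^+ k.+1) = (f ^+ k * euler_deriv f) *+ k.+1.
Proof.
elim: k => [|k IHk]; first by rewrite mul1r.
by rewrite exprS euler_derivM IHk mulrnAr mulrA -exprS [in RHS]mulrS [euler_deriv f * _]mulrC.
Qed.

(* The [u] of the header. *)
Definition block : fps := Z * (one_minus_z * fps_inv one_plus_z).

Lemma one_plus_z_inv : one_plus_z * fps_inv one_plus_z = 1.
Proof. by rewrite fps_mulV // one_plus_zE coefD_fps /Z /fps_of_poly coefX. Qed.

Lemma block_one_plus_z : (1 + Z) * block = Z * (1 - Z).
Proof.
have := one_plus_z_inv; rewrite /block one_plus_zE one_minus_zE => H.
transitivity (Z * (1 - Z) * ((1 + Z) * fps_inv (1 + Z))); first by ring.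
by rewrite H mulr1.
Qed.

(** The second hypothesis is the Leibniz rule applied to both sides of the first, with [d] for the
    Euler derivative of [u], and 0 and [z] for those of 1 and [z]. *)
Lemma quad_of_deriv (R : comNzRingType) (z u d : R) :
  (1 + z) * u = z * (1 - z) ->
  (0 + z) * u + (1 + z) * d = z * (1 - z) + z * (0 - z) ->
  (1 + z) ^+ 2 * d = z * (1 - z *+ 2 - z ^+ 2).
Proof.
move=> uE dE.
have -> : (1 + z) ^+ 2 * d = (1 + z) * ((0 + z) * u + (1 + z) * d) - z * ((1 + z) * u).
  by ring.
by rewrite dE uE; ring.
Qed.

Lemma euler_deriv_block :
  euler_deriv block = Z * quad * fps_inv (fps_pow one_plus_z 2).
Proof.
have unit2 : (1 + Z) ^+ 2 * fps_inv ((1 + Z) ^+ 2) = 1.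
  apply: fps_mulV; rewrite expr2 mulrDl mul1r !coefD_fps coefZ_mul0 addr0.
  by rewrite /Z /fps_of_poly coefX addr0 oner_eq0.
rewrite fps_powE one_plus_zE quadE.
move: block block_one_plus_z => u uE; have := congr1 euler_deriv uE.
rewrite !euler_derivM !euler_derivD euler_derivN euler_deriv1 euler_derivZ.
set i := fps_inv _ in unit2 *; set D := euler_deriv u => H.
have {}H : (1 + Z) ^+ 2 * D = Z * (1 - Z *+ 2 - Z ^+ 2).
  apply: quad_of_deriv uE H.
by rewrite -H mulrAC unit2 mul1r.
Qed.

(** The power rule absorbs the factor [m.+1] of the factorial: the term is [m!] times the Euler
    derivative of [block ^+ m.+1]. The resulting factor [n] matches the rotations counted in
    [card_CK]. *)
Lemma rhs_termS m n : rhs_term m.+1 n = (block ^+ m.+1) n *+ (m`! * n).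
Proof.
have -> : rhs_term m.+1 = euler_deriv (block ^+ m.+1) *+ m`!.
  rewrite euler_derivX /rhs_term fps_scale_natr !fps_powE euler_deriv_block.
  rewrite fps_powE /= -mulrnA -factS.
  by congr (_ *+ _); rewrite /block !exprMn -[RHS]mulrA.
by rewrite coefMn_fps -mulrnA mulnC.
Qed.

Lemma coef_blockX_lt m n : (n < m)%N -> (block ^+ m) n = 0.
Proof. by move=> lt_nm; rewrite /block exprMn coefZX_mul_lt. Qed.

(** * Inclusion-exclusion *)

(** The signed series of blocks of length at least two, [-2z^2 + 2z^3 - ...]: two directions, and a
    sign for each marked pair inside the block. *)
Definition tail_block : fps := block - Z.

Lemma tail_block_rec : tail_block + Z * tail_block = - (Z * (Z *+ 2)).
Proof.
have : (1 + Z) * tail_block = (1 + Z) * block - (1 + Z) * Z by rewrite mulrBr.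
rewrite block_one_plus_z mulrDl mul1r => ->.
by rewrite mulrBr mulrDl !mul1r mulr1 mulr2n mulrDr; ring.
Qed.

Fixpoint bitseqs (k : nat) : seq bitseq :=
  if k is k'.+1
  then [seq rcons T false | T <- bitseqs k'] ++ [seq rcons T true | T <- bitseqs k']
  else [:: [::]].

Lemma size_bitseqs k T : T \in bitseqs k -> size T = k.
Proof.
elim: k T => [|k IHk] T /=; first by rewrite inE => /eqP->.
by rewrite mem_cat => /orP[] /mapP[T' /IHk <- ->]; rewrite size_rcons.
Qed.

Lemma big_bitseqsS (V : nmodType) k (P : pred bitseq) (F : bitseq -> V) :
  \sum_(T <- bitseqs k.+1 | P T) F T =
  \sum_(T <- bitseqs k | P (rcons T false)) F (rcons T false) +
  \sum_(T <- bitseqs k | P (rcons T true)) F (rcons T true).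
Proof. by rewrite big_cat !big_map. Qed.

(** Expanding the product, [T] marks the factors from which [- b i] is taken. *)
Lemma prod_compl_bitseqs (R : comNzRingType) k (b : nat -> bool) :
  \prod_(i < k) (1 - (b i)%:R : R) =
  \sum_(T <- bitseqs k)
    (-1) ^+ count id T * (all (fun i => nth false T i ==> b i) (iota 0 (size T)))%:R.
Proof.
elim: k => [|k IHk]; first by rewrite big_ord0 big_seq1 mul1r.
rewrite big_ord_recr /= IHk big_bitseqsS mulr_suml -big_split big_seq [RHS]big_seq.
apply: eq_bigr => T /size_bitseqs sT; rewrite !count_rcons !size_rcons.
have allE c : all (fun i => nth false (rcons T c) i ==> b i) (iota 0 (size T).+1) =
    all (fun i => nth false T i ==> b i) (iota 0 (size T)) && (c ==> b k).
  rewrite -addn1 iotaD all_cat /= andbT add0n nth_rcons ltnn eqxx sT; congr andb.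
  apply: eq_in_all => i; rewrite mem_iota add0n /= => lti.
  by rewrite nth_rcons sT lti.
rewrite !allE andbT addn0 addn1 exprS; case: all (b k) => [] [] /=;
  by rewrite ?(mulr0, mulr1, subrr, addr0, subr0, mul0r) ?mulN1r ?subrr.
Qed.

(** The signed sum over markings of [k] pairs into [d.+1] blocks; [f] tells whether the last block
    has length at least two, which is what appending a pair must know. *)
Definition run_sum (k d : nat) (f : bool) : rat :=
  \sum_(T <- bitseqs k | (count negb T == d) && (last false T == f))
    (-1) ^+ count id T * (2 ^ runs false T)%:R.

Lemma run_sum_split k d :
  \sum_(T <- bitseqs k | count negb T == d) (-1) ^+ count id T * (2 ^ runs false T)%:R
  = run_sum k d false + run_sum k d true.
Proof.
rewrite (bigID (fun T => last false T == false)) /=; congr (_ + _).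
by apply: eq_bigl => T; case: (last _ _).
Qed.

Lemma run_sum0 d f : run_sum 0 d f = ((d == 0%N) && ~~ f)%:R.
Proof.
by rewrite /run_sum big_cons big_nil; case: d f => [|d] [] //=; rewrite addr0 mul1r.
Qed.

Lemma run_sumS_false0 k : run_sum k.+1 0 false = 0.
Proof.
rewrite /run_sum big_bitseqsS !big_pred0 ?addr0 // => T; rewrite count_rcons ?addn1 //.
by rewrite last_rcons andbF.
Qed.

Lemma run_sumS_false k d : run_sum k.+1 d.+1 false = run_sum k d false + run_sum k d true.
Proof.
rewrite -run_sum_split /run_sum big_bitseqsS [X in _ + X]big_pred0 => [|T].
  rewrite addr0; apply: eq_big => T; rewrite !count_rcons ?last_rcons.
    by rewrite addn1 eqSS andbT.
  by rewrite runs_rcons !addn0.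
by rewrite last_rcons andbF.
Qed.

(** A marked pair changes the sign; it brings a factor 2 only if the last block had length one,
    since a longer block already has its direction. *)
Lemma run_sumS_true k d :
  run_sum k.+1 d true = - (run_sum k d false *+ 2) - run_sum k d true.
Proof.
rewrite /run_sum big_bitseqsS [X in X + _]big_pred0 => [|T].
  rewrite add0r (bigID (fun T => last false T == false)) /= -sumrMnl -!sumrN.
  congr (_ + _); apply: eq_big => T; rewrite ?count_rcons ?last_rcons ?addn0 ?andbT //.
  - move=> /andP[_ /eqP lastT]; rewrite runs_rcons lastT addn1 exprS.
    by rewrite expnD natrM mulrA mulN1r !mulNr -[in RHS](mulr_natr _ 2).
  - by case: (last _ _).
  - move=> /andP[_]; case: (boolP (last _ _)) => // lastT _.
    by rewrite runs_rcons lastT addn0 addn1 exprS mulN1r mulNr.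
by rewrite last_rcons andbF.
Qed.

Lemma coef_tail_blockS d n :
  (tail_block * block ^+ d) n.+1 =
  - ((Z * block ^+ d) n *+ 2) - (tail_block * block ^+ d) n.
Proof.
have /(congr1 (fun h : fps => (h * block ^+ d) n.+1)) := tail_block_rec.
rewrite mulrDl coefD_fps -mulrA coefZ_mulS => /(canRL (addrK _)) ->.
by rewrite mulNr coefN_fps -mulrA coefZ_mulS mulrnAl coefMn_fps.
Qed.

(** The first [d] blocks contribute [block ^+ d], the last one [Z] or [tail_block] according to its
    length. The degree is [k.+1] because [k] pairs link [k.+1] values. Both sides satisfy the same
    recursion in [k]. *)
Lemma run_sumE k d f :
  run_sum k d f = ((if f then tail_block else Z) * block ^+ d) k.+1.
Proof.
elim: k d f => [|k IHk] d f.
  rewrite run_sum0; case: f; rewrite ?coefZ_mulS.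
    rewrite andbF coef_tail_blockS coefZ_mul0 mul0rn oppr0 add0r /tail_block mulrBl.
    by rewrite coefD_fps coefN_fps coefZ_mul0 -exprS coef_blockX_lt // !subr0 oppr0.
  by case: d => [|d] //; rewrite coef_blockX_lt.
case: f; first by rewrite run_sumS_true !IHk [RHS]coef_tail_blockS.
case: d => [|d]; first by rewrite run_sumS_false0 coefZ_mulS.
by rewrite run_sumS_false coefZ_mulS !IHk -coefD_fps -mulrDl /tail_block addrC subrK exprS.
Qed.

Lemma sum_marked_bitseqs k :
  \sum_(T <- bitseqs k)
    (-1) ^+ count id T * ((count negb T)`! * 2 ^ runs false T)%:R =
  \sum_(d < k.+1) (block ^+ d.+1) k.+1 *+ d`!.
Proof.
transitivity (\sum_(T <- bitseqs k) \sum_(d < k.+1 | count negb T == d)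
    (-1) ^+ count id T * (d`! * 2 ^ runs false T)%:R : rat).
  rewrite big_seq [RHS]big_seq; apply: eq_bigr => T /size_bitseqs sT.
  have lt_d : (count negb T < k.+1)%N by rewrite ltnS -sT count_size.
  rewrite (big_pred1 (Ordinal lt_d)) //.
rewrite (exchange_big_dep predT) //=; apply: eq_bigr => d _.
transitivity ((run_sum k d false + run_sum k d true) *+ d`!).
  rewrite -run_sum_split -sumrMnl; apply: eq_bigr => T _.
  by rewrite natrM mulrCA mulr_natl.
by rewrite !run_sumE -coefD_fps -mulrDl /tail_block addrC subrK exprS.
Qed.

Lemma prod_compl_all (R : comNzRingType) k (b : nat -> bool) :
  (\prod_(i < k) (1 - (b i)%:R : R) = (all (fun i => ~~ b i) (iota 0 k))%:R)%R.
Proof.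
elim: k => [|k IHk]; first by rewrite big_ord0.
rewrite big_ord_recr [LHS]/= IHk -[k.+1]addn1 iotaD all_cat /= andbT add0n.
by case: all (b k) => [] []; rewrite ?subrr ?subr0 ?mulr1 ?mulr0.
Qed.

Lemma count_non_adjacent k : (1 < k)%N ->
  ((count (non_adjacent k) (cyclic_words k))%:R =
  \sum_(d < k.+1) (block ^+ d.+1) k.+1 *+ d`! :> rat)%R.
Proof.
move=> k_gt1; rewrite -sum1_count big_mkcond natr_sum -sum_marked_bitseqs.
transitivity (\sum_(w <- cyclic_words k) \sum_(T <- bitseqs k)
    (-1) ^+ count id T * (adjacent_on T w)%:R : rat)%R.
  apply: eq_bigr => w _; rewrite -(prod_compl_bitseqs _ k (fun i => cyc_adjacent w i i.+1)).
  rewrite (prod_compl_all _ k (fun i => cyc_adjacent w i i.+1)) -/(non_adjacent k w).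
  by case: ifP.
(* After the exchange, the inner sum for a fixed [T] is [marked_count k T]. *)
rewrite exchange_big big_seq [RHS]big_seq; apply: eq_bigr => T /size_bitseqs szT.
rewrite -mulr_sumr -natr_sum -(marked_countE k_gt1 szT) /marked_count.
rewrite -[count _ (cyclic_words k)]sum1_count.
by rewrite [in RHS]big_mkcond; congr (_ * _%:R)%R; apply: eq_bigr => w _; case: adjacent_on.
Qed.

(* CK(z) = 2 z^2 + sum_{m>=1} m! z^(m-1) ((1-z)/(1+z))^(m-1) z(1-2z-z^2)/(1+z)^2 *)
Theorem theorem4p2 :
  fps_series_sums_to rhs_term (fun n => CK_gf n - two_z2 n).
Proof.
(* Since [block] is divisible by [Z], the terms of index above [n] have no coefficient in degree
   [n]. *)
move=> n; exists n => M le_nM.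
transitivity ((\sum_(d < n) (block ^+ d.+1) n *+ d`!) *+ n).
  rewrite /fps_partial_sum big_add1 -(big_mkord xpredT (fun d => (block ^+ d.+1) n *+ d`!)).
  have tail0 : \sum_(n <= d < M) rhs_term d.+1 n = 0.
    rewrite big_nat; apply: big1 => d /andP[le_nd _].
    by rewrite rhs_termS coef_blockX_lt ?mul0rn.
  rewrite (big_cat_nat (n := n)) //= tail0 addr0 -sumrMnl.
  by apply: eq_bigr => d _; rewrite rhs_termS mulrnA.
have two_z2E i : two_z2 i = 2%:R * (i == 2)%:R by rewrite /two_z2 /fps_of_poly coefZ coefXn.
(* Degrees below 3 are evaluated directly. In degree 2 the signed sum is [1 - 2 = -1], giving [-2]
   after multiplication by [n], while [CK 2] is empty: the difference is the term [2z^2]. *)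
case: n {le_nM} => [|[|[|k]]]; rewrite two_z2E /CK_gf.
- by rewrite mulr0n mulr0 subr0.
- by rewrite -sum_marked_bitseqs big_seq1 card_CK1 mulr0 subr0.
- by rewrite -sum_marked_bitseqs card_CK2 !big_cons big_nil.
by rewrite -count_non_adjacent // card_CK // natrM mulr_natl mulr0 subr0.
Qed.
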